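(* Let $Q$ be a $3$-divisible Moufang loop and let $X$ be a normal subloop of $Q$. Then $X$ induces an abelian congruence of $Q$ if and only if $u\cdot(x\cdot y) = (u\cdot y)\cdot x$ for all $u\in Q$ and all $x,y\in X$.
   Context: A loop is an algebra $(Q,\cdot,\backslash,/,1)$ satisfying $x\backslash(x\cdot y)=x\cdot(x\backslash y)=y=(y\cdot x)/x=(y/x)\cdot x$ and $x\cdot 1=x=1\cdot x$. A Moufang loop is a loop satisfying $x(y(xz))=((xy)x)z$ for all $x,y,z$; any two elements of a Moufang loop generate a group, so powers are well defined. A Moufang loop $Q$ is $3$-divisible if the map $x\mapsto x^3$ is onto $Q$. For $u\in Q$ let $L_u(v)=uv$, $R_u(v)=vu$, and $\mathrm{Mlt}(Q)=\langle L_u,R_u:u\in Q\rangle$. An inner mapping of $Q$ is an element of $\mathrm{Mlt}(Q)$ that fixes $1$. A subloop $X$ of $Q$ is normal if it is invariant under all inner mappings of $Q$ (equivalently, $X$ is the class containing $1$ of some congruence of $Q$). A normal subloop $X$ of $Q$ induces the congruence $\alpha_X$ of $Q$ given by $u\,\alpha_X\,v$ iff $uX=vX$. A congruence $\alpha$ of $Q$ is abelian if for every $n\ge 0$, every $(n+1)$-ary term operation $t$ in the signature $(\cdot,\backslash,/,1)$ and all $a,b,u_1,v_1,\dots,u_n,v_n\in Q$ with $a\,\alpha\,b$ and $u_i\,\alpha\,v_i$ for all $i$: if $t(a,u_1,\dots,u_n)=t(a,v_1,\dots,v_n)$ then $t(b,u_1,\dots,u_n)=t(b,v_1,\dots,v_n)$.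 ''$X$ induces an abelian congruence of $Q$'' means that $\alpha_X$ is abelian. *)

(* Defs.v *)
(* Loops are not assumed associative, finite or decidable, so they are built  *)
(* over a bare Type and subsets are Prop-valued.                              *)
From HB Require Import structures.
From mathcomp Require Import all_boot.

Set Implicit Arguments.
Unset Strict Implicit.
Unset Printing Implicit Defensive.

Declare Scope loop_scope.
Delimit Scope loop_scope with L.
Local Open Scope loop_scope.

HB.mixin Record isLoop Q := {
  lmul : Q -> Q -> Q;
  ldiv : Q -> Q -> Q;  (* ldiv x y is x \ y *)
  rdiv : Q -> Q -> Q;  (* rdiv y x is y / x *)
  lone : Q;
  ldiv_lmul : forall x y, ldiv x (lmul x y) = y;
  lmul_ldiv : forall x y, lmul x (ldiv x y) = y;
  rdiv_lmul : forall x y, rdiv (lmul y x) x = y;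
  lmul_rdiv : forall x y, lmul (rdiv y x) x = y;
  lmulx1 : forall x, lmul x lone = x;
  lmul1x : forall x, lmul lone x = x
}.

#[short(type="loopType")]
HB.structure Definition Loop := { Q of isLoop Q }.

Notation "x * y" := (lmul x y) : loop_scope.
Notation "1" := lone : loop_scope.

Definition moufang (Q : loopType) : Prop :=
  forall x y z : Q, x * (y * (x * z)) = ((x * y) * x) * z.

(* Right-nested power; by diassociativity the bracketing is irrelevant in a   *)
(* Moufang loop.                                                              *)
Definition lexp (Q : loopType) (x : Q) (n : nat) : Q := iter n (lmul x) 1.

Definition divisible (Q : loopType) (n : nat) : Prop :=
  forall y : Q, exists x : Q, lexp x n = y.

Definition ltrans (Q : loopType) (u : Q) : Q -> Q := fun v => u * v.
Definition rtrans (Q : loopType) (u : Q) : Q -> Q := fun v => v * u.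

Inductive Mlt (Q : loopType) : (Q -> Q) -> Prop :=
| Mlt_ltrans u : Mlt (ltrans u)
| Mlt_rtrans u : Mlt (rtrans u)
| Mlt_id : Mlt id
| Mlt_comp f g : Mlt f -> Mlt g -> Mlt (f \o g)
| Mlt_inv f g : Mlt f -> cancel f g -> cancel g f -> Mlt g.

Definition inner_mapping (Q : loopType) (f : Q -> Q) : Prop :=
  Mlt f /\ f 1 = 1.

Record subloop (Q : loopType) (X : Q -> Prop) : Prop := Subloop {
  subloop1 : X 1;
  subloopM : forall x y, X x -> X y -> X (x * y);
  subloop_ldiv : forall x y, X x -> X y -> X (ldiv x y);
  subloop_rdiv : forall x y, X x -> X y -> X (rdiv x y)
}.

Definition normal_subloop (Q : loopType) (X : Q -> Prop) : Prop :=
  subloop X /\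
  (forall f : Q -> Q, inner_mapping f -> forall x, X x -> X (f x)).

Definition lcoset (Q : loopType) (u : Q) (X : Q -> Prop) : Q -> Prop :=
  fun w => exists2 x, X x & w = u * x.

(* Equality of u X and v X as subsets, i.e. extensionally.                    *)
Definition coset_rel (Q : loopType) (X : Q -> Prop) (u v : Q) : Prop :=
  forall w, lcoset u X w <-> lcoset v X w.

Record congruence (Q : loopType) (alpha : Q -> Q -> Prop) : Prop := Congruence {
  congr_refl : forall x, alpha x x;
  congr_sym : forall x y, alpha x y -> alpha y x;
  congr_trans : forall x y z, alpha x y -> alpha y z -> alpha x z;
  congr_lmul : forall x x' y y',
    alpha x x' -> alpha y y' -> alpha (x * y) (x' * y');
  congr_ldiv : forall x x' y y',
    alpha x x' -> alpha y y' -> alpha (ldiv x y) (ldiv x' y');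
  congr_rdiv : forall x x' y y',
    alpha x x' -> alpha y y' -> alpha (rdiv x y) (rdiv x' y')
}.

Inductive term (n : nat) : Type :=
| TVar of 'I_n
| TOne
| TMul of term n & term n
| TLdiv of term n & term n
| TRdiv of term n & term n.

Arguments TOne {n}.

Fixpoint eval (Q : loopType) (n : nat) (t : term n) (e : n.-tuple Q) : Q :=
  match t with
  | TVar i => tnth e i
  | TOne => 1
  | TMul t1 t2 => eval t1 e * eval t2 e
  | TLdiv t1 t2 => ldiv (eval t1 e) (eval t2 e)
  | TRdiv t1 t2 => rdiv (eval t1 e) (eval t2 e)
  end.

Definition abelian_congruence (Q : loopType) (alpha : Q -> Q -> Prop) : Prop :=
  congruence alpha /\
  (forall (n : nat) (t : term n.+1) (a b : Q) (u v : n.-tuple Q),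
     alpha a b ->
     (forall i : 'I_n, alpha (tnth u i) (tnth v i)) ->
     eval t [tuple of a :: u] = eval t [tuple of a :: v] ->
     eval t [tuple of b :: u] = eval t [tuple of b :: v]).

Definition induces_abelian_congruence (Q : loopType) (X : Q -> Prop) : Prop :=
  abelian_congruence (coset_rel X).

(* Main.v *)
(* If u(xy) = (uy)x for u in Q and x, y in X, then X is an abelian group that
   associates with all of Q.  Inner mappings of a Moufang loop are
   pseudoautomorphisms, so they restrict to automorphisms of X.  Conjugation by
   w has companion w^3: f(x)(f(y)w^3) = f(xy)w^3.  Since every r in Q is a cube,
   this identity applies to the products (sb)(ra) and gives
   (sb)(ra) = (sr)(phi(b) psi(a)) on X with inner mappings phi, psi depending on
   r and s only.  Hence the operations of Q are affine over X, and the relation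
   "p, px, py, (py)x with x, y in X" is preserved by all of them, which is the
   term condition. *)
Require Import Defs.
From HB Require Import structures.
From mathcomp Require Import all_boot.

Local Open Scope loop_scope.

(** * Loops, translations and inner mappings *)

Section LoopTheory.
Set Implicit Arguments.
Unset Strict Implicit.
Variable Q : loopType.
Implicit Types x y z u : Q.

Lemma lmul_inj x : injective (lmul x).
Proof. exact: can_inj (ldiv_lmul x). Qed.

Lemma rmul_inj x : injective (lmul^~ x).
Proof. exact: (can_inj (g := rdiv^~ x) (rdiv_lmul x)). Qed.

Lemma ldiv_eq x y z : x * z = y -> ldiv x y = z.
Proof. by move<-; rewrite ldiv_lmul. Qed.

Lemma rdiv_eq x y z : z * x = y -> rdiv y x = z.
Proof. by move<-; rewrite rdiv_lmul. Qed.

Lemma ldivx1 x : ldiv x x = 1.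
Proof. by apply: ldiv_eq; rewrite lmulx1. Qed.

Lemma rdivx1 x : rdiv x x = 1.
Proof. by apply: rdiv_eq; rewrite lmul1x. Qed.

Lemma Mlt_ldiv u : Mlt (fun v : Q => ldiv u v).
Proof. by apply: (Mlt_inv (Mlt_ltrans u)) => v; rewrite /ltrans ?ldiv_lmul ?lmul_ldiv. Qed.

Lemma Mlt_rdiv u : Mlt (fun v : Q => rdiv v u).
Proof. by apply: (Mlt_inv (Mlt_rtrans u)) => v; rewrite /rtrans ?rdiv_lmul ?lmul_rdiv. Qed.

Lemma Mlt_bij (f : Q -> Q) : Mlt f -> bijective f.
Proof.
elim=> {f} [u|u||f g _ bf _ bg|f g _ _ fK gK].
- by exists (ldiv u) => v; rewrite /ltrans ?ldiv_lmul ?lmul_ldiv.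
- by exists (rdiv^~ u) => v; rewrite /rtrans ?rdiv_lmul ?lmul_rdiv.
- by exists id.
- exact: bij_comp.
- by exists f.
Qed.

Lemma inner_inv (f : Q -> Q) : inner_mapping f ->
  exists2 g, inner_mapping g & cancel f g /\ cancel g f.
Proof.
move=> [Mf f1]; have [g fK gK] := Mlt_bij Mf.
exists g => //; split; first exact: Mlt_inv Mf fK gK.
by rewrite -{1}f1 fK.
Qed.

Lemma inner_comp (f g : Q -> Q) :
  inner_mapping f -> inner_mapping g -> inner_mapping (f \o g).
Proof. by move=> [Mf f1] [Mg g1]; split; [exact: Mlt_comp|rewrite /= g1]. Qed.

Lemma inner_conj w : inner_mapping (fun x : Q => rdiv (w * x) w).
Proof.
split; first exact: Mlt_comp (Mlt_rdiv w) (Mlt_ltrans w).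
by rewrite lmulx1 rdivx1.
Qed.

(** [f] is the first component of an autotopism [(f, g, h)]. Bijectivity of [g] and [h] lets the
    property pass to inverses. *)
Definition autotopic (f : Q -> Q) : Prop :=
  exists g h, [/\ bijective g, bijective h & forall x y, f x * g y = h (x * y)].

End LoopTheory.

(** * Moufang loops: inverses, autotopisms and pseudoautomorphisms *)

Section MoufangTheory.
Set Implicit Arguments.
Unset Strict Implicit.
Variables (Q : loopType) (hQ : moufang Q).
Implicit Types x y z u w : Q.

Definition linv x : Q := ldiv x 1.

Lemma moufang_flex x y : x * (y * x) = (x * y) * x.
Proof. by have := hQ x y 1; rewrite !lmulx1. Qed.

Lemma mulVK x y : linv x * (x * y) = y.
Proof.
by apply: (@lmul_inj _ x); rewrite hQ /linv lmul_ldiv lmul1x.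
Qed.

Lemma mulKV x y : x * (linv x * y) = y.
Proof. by rewrite -{1}(lmul_ldiv x y) mulVK lmul_ldiv. Qed.

Lemma mulxV x : x * linv x = 1.
Proof. exact: lmul_ldiv. Qed.

Lemma mulrK x y : (y * x) * linv x = y.
Proof.
by rewrite -(lmul_ldiv x y) -hQ mulxV lmulx1.
Qed.

Lemma linvM x y : linv (x * y) = linv y * linv x.
Proof.
have -> : linv y = linv (x * y) * x by rewrite -{1}(mulVK (x * y) (linv y)) mulrK.
by rewrite mulrK.
Qed.

Lemma linvK x : linv (linv x) = x.
Proof. by apply: ldiv_eq; have := mulVK x 1; rewrite lmulx1. Qed.

(** Inversion is an antiautomorphism, so this is the mirror image of the left Moufang law. *)
Lemma moufang_right x y z : ((z * x) * y) * x = z * (x * (y * x)).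
Proof.
apply: (can_inj linvK).
by rewrite !linvM hQ.
Qed.

Lemma moufang_middle x y z : (x * y) * (z * x) = (x * (y * z)) * x.
Proof.
have -> : x * y = ((x * (y * z)) * x) * linv (z * x).
  by rewrite linvM -hQ mulKV mulrK.
by rewrite -{2}(linvK (z * x)) mulrK.
Qed.

Lemma Mlt_autotopic (f : Q -> Q) : Mlt f -> autotopic f.
Proof.
have bijL u : bijective (lmul u) := Mlt_bij (Mlt_ltrans u).
have bijR u : bijective (lmul^~ u) := Mlt_bij (Mlt_rtrans u).
have inv_at (g g' : Q -> Q) : cancel g g' -> cancel g' g -> autotopic g -> autotopic g'.
  move=> gK g'K [h [k [[h' hK h'K] [k' kK k'K] E]]].
  exists h', k'; split; [by exists h|by exists k|] => x y.
  by apply: (can_inj kK); rewrite k'K -E g'K h'K.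
elim=> {f} [u|u||f g _ [g1 [h1 [bg1 bh1 E1]]] _ [g2 [h2 [bg2 bh2 E2]]]|f g _ af fK gK].
- exists (lmul^~ u), (lmul^~ u \o lmul u); split => //; first exact: bij_comp.
  by move=> x y; rewrite /= -moufang_middle.
- have RK : cancel (rdiv^~ u) (rtrans u) by move=> v; exact: lmul_rdiv.
  have KR : cancel (rtrans u) (rdiv^~ u) by move=> v; exact: rdiv_lmul.
  apply: (inv_at _ _ RK KR).
  exists (lmul u \o lmul^~ u), (lmul^~ u); split => //; first exact: bij_comp.
  by move=> x y; rewrite /= -moufang_right lmul_rdiv.
- by exists id, id; split => //; exists id.
- exists (g1 \o g2), (h1 \o h2); split; [exact: bij_comp|exact: bij_comp|].
  by move=> x y; rewrite /= E1 E2.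
- exact: inv_at fK gK af.
Qed.

(** Complete [f] to an autotopism [(f, g, h)]. Since [f 1 = 1], putting [x = 1] gives [g = h], and
    then [y = 1] gives [g x = f x * g 1]. The companion is [g 1]. *)
Lemma inner_pseudoaut (f : Q -> Q) : inner_mapping f ->
  exists c, forall x y, f x * (f y * c) = f (x * y) * c.
Proof.
move=> [Mf f1]; have [g [h [_ _ E]]] := Mlt_autotopic Mf.
have gh y : g y = h y by rewrite -{2}(lmul1x y) -E f1 lmul1x.
have gc y : g y = f y * g 1 by rewrite E lmulx1 gh.
by exists (g 1) => x y; rewrite -!gc E gh.
Qed.

Lemma lexp3 w : lexp w 3 = w * (w * w).
Proof. by rewrite /lexp /= lmulx1. Qed.

Lemma conj_pseudoaut w x y :
  rdiv (w * x) w * (rdiv (w * y) w * lexp w 3) = rdiv (w * (x * y)) w * lexp w 3.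
Proof.
(* The right Moufang law absorbs the companion, which leaves an identity without cubes. *)
have cube z : rdiv z w * lexp w 3 = (z * w) * w.
  by rewrite lexp3 -moufang_right lmul_rdiv.
rewrite !cube -moufang_middle.
by rewrite -[w * x in RHS](lmul_rdiv w) moufang_right !moufang_flex.
Qed.

End MoufangTheory.

(** * From the identity on [X] to the term condition *)

Section Sufficiency.
Set Implicit Arguments.
Unset Strict Implicit.
Variables (Q : loopType) (hQ : moufang Q) (h3 : divisible Q 3).
Variables (X : Q -> Prop) (hX : normal_subloop X).
Hypothesis XP : forall u x y : Q, X x -> X y -> u * (x * y) = (u * y) * x.

Let XM x y : X x -> X y -> X (x * y).
Proof. exact: (subloopM hX.1). Qed.

Let Xldiv x y : X x -> X y -> X (ldiv x y).
Proof. exact: (subloop_ldiv hX.1). Qed.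

Let X1 : X 1.
Proof. exact: (subloop1 hX.1). Qed.

Let XI f x : inner_mapping f -> X x -> X (f x).
Proof. by move=> If; exact: (hX.2 _ If). Qed.

Lemma X_comm x y : X x -> X y -> x * y = y * x.
Proof. by move=> Xx Xy; rewrite -[LHS]lmul1x XP // lmul1x. Qed.

Lemma X_assocr u x y : X x -> X y -> u * (x * y) = (u * x) * y.
Proof. by move=> Xx Xy; rewrite (X_comm Xx Xy) XP. Qed.

Lemma X_assocl u x y : X x -> X y -> x * (y * u) = (x * y) * u.
Proof.
move=> Xx Xy; apply: (can_inj (linvK hQ)).
by rewrite !(linvM hQ) X_assocr //; exact: Xldiv.
Qed.

Lemma X_interchange x x' y y' : X x -> X x' -> X y -> X y' ->
  (x * x') * (y * y') = (x * y) * (x' * y').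
Proof.
move=> Xx Xx' Xy Xy'.
rewrite -!X_assocr //; try exact: XM.
by congr (x * _); rewrite !X_assocr // (X_comm Xx').
Qed.

Lemma X_ldiv_hom x x' y y' : X x -> X x' -> X y -> X y' ->
  ldiv (x * x') (y * y') = ldiv x y * ldiv x' y'.
Proof.
move=> Xx Xx' Xy Xy'; apply: ldiv_eq.
by rewrite X_interchange ?lmul_ldiv //; exact: Xldiv.
Qed.

(** The companion [c] may lie outside [X], but two elements of [X] associate with any third factor
    on the right, so [c] cancels. *)
Lemma inner_hom f x y : inner_mapping f -> X x -> X y -> f (x * y) = f x * f y.
Proof.
move=> If Xx Xy; have [c E] := inner_pseudoaut hQ If.
by apply: (@rmul_inj _ c); rewrite -E X_assocl //; exact: XI.
Qed.

Lemma affine_lmul s r : exists phi psi,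
  [/\ inner_mapping phi, inner_mapping psi &
      forall b a, X b -> X a -> (s * b) * (r * a) = (s * r) * (phi b * psi a)].
Proof.
(* With [w] a cube root of [r], the companion of conjugation by [w] is [r] itself. *)
have [w rE] := h3 r.
pose f x := rdiv (w * x) w.
have If : inner_mapping f := inner_conj w.
have key x y : f x * (f y * r) = f (x * y) * r by rewrite -rE; exact: conj_pseudoaut.
have [f' If' [fK f'K]] := inner_inv If.
(* As [f s' = s], the map [f] sends the coset of [s'] to that of [s], acting there as [sigma]. *)
pose s' := f' s.
pose sigma c := ldiv s (f (s' * c)).
have Is : inner_mapping sigma.
  split; last by rewrite /sigma lmulx1 f'K ldivx1.
  exact: Mlt_comp (Mlt_ldiv s) (Mlt_comp If.1 (Mlt_ltrans s')).
have [sigma' Is' [sK s'K]] := inner_inv Is.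
have fs c : f (s' * c) = s * sigma c by rewrite lmul_ldiv.
pose phi c := ldiv (s * r) ((s * c) * r).
have Ip : inner_mapping phi.
  split; last by rewrite /phi lmulx1 ldivx1.
  exact: Mlt_comp (Mlt_ldiv _) (Mlt_comp (Mlt_rtrans r) (Mlt_ltrans s)).
pose tau := fun c => rdiv (r * c) r.
have It : inner_mapping tau := inner_conj r.
pose psi := phi \o (sigma \o (f' \o tau)).
exists phi, psi; split => //; first by do 3![apply: inner_comp => //].
move=> b a Xb Xa.
have Xt : X (f' (tau a)) by do 2![apply: XI => //].
have Xb' : X (sigma' b) by exact: XI.
(* Write [s * b] as [f (s' * sigma' b)] and [r * a] as [f (f' (tau a)) * r]. Then [key] merges both
   under one [f], where the [X] factors can be collected. *)
rewrite -{1}(s'K b) -fs -(lmul_rdiv r (r * a)) -/(tau a) -{1}(f'K (tau a)) key.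
rewrite -X_assocr // fs inner_hom // s'K.
rewrite /psi /= -inner_hom //; last exact: XI.
by rewrite lmul_ldiv.
Qed.

(** The linear part [F] may depend on the base points [p], [q], and is constrained only on [X]. *)
Definition affine_op (op : Q -> Q -> Q) : Prop := forall p q, exists F : Q -> Q -> Q,
  [/\ forall x y, X x -> X y -> X (F x y),
      forall x x' y y', X x -> X x' -> X y -> X y' ->
        F (x * x') (y * y') = F x y * F x' y' &
      forall x y, X x -> X y -> op (p * x) (q * y) = op p q * F x y].

Lemma affine_op_lmul : affine_op lmul.
Proof.
move=> p q; have [phi [psi [Ip Iq E]]] := affine_lmul p q.
exists (fun x y => phi x * psi y); split => //.
- by move=> x y Xx Xy; apply: XM; exact: XI.
- move=> x x' y y' Xx Xx' Xy Xy'; rewrite (inner_hom Ip) // (inner_hom Iq) //.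
  by apply: X_interchange; apply: XI.
Qed.

Lemma affine_op_ldiv : affine_op ldiv.
Proof.
(* Linearize the product at [p] and [ldiv p q], then solve for the second factor. *)
move=> p q; have [phi [psi [Ip Iq E]]] := affine_lmul p (ldiv p q).
have [psi' Iq' [_ psiK]] := inner_inv Iq.
have XF x y : X x -> X y -> X (ldiv (phi x) y).
  by move=> Xx Xy; exact: Xldiv (XI Ip Xx) Xy.
exists (fun x y => psi' (ldiv (phi x) y)); split.
- by move=> x y Xx Xy; exact: XI (XF _ _ Xx Xy).
- move=> x x' y y' Xx Xx' Xy Xy'.
  rewrite (inner_hom Ip) // (X_ldiv_hom (XI Ip Xx) (XI Ip Xx')) //.
  exact: inner_hom (XF _ _ Xx Xy) (XF _ _ Xx' Xy').
- move=> x y Xx Xy; apply: ldiv_eq; rewrite E ?psiK ?lmul_ldiv //.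
  exact: XI (XF _ _ Xx Xy).
Qed.

Lemma affine_op_rdiv : affine_op rdiv.
Proof.
move=> p q; have [phi [psi [Ip Iq E]]] := affine_lmul (rdiv p q) q.
have [phi' Ip' [_ phiK]] := inner_inv Ip.
have XF x y : X x -> X y -> X (ldiv (psi y) x).
  by move=> Xx Xy; exact: Xldiv (XI Iq Xy) Xx.
(* As [X] is commutative, a left quotient can stand for the right one, so [X_ldiv_hom] applies
   again. *)
exists (fun x y => phi' (ldiv (psi y) x)); split.
- by move=> x y Xx Xy; exact: XI (XF _ _ Xx Xy).
- move=> x x' y y' Xx Xx' Xy Xy'.
  rewrite (inner_hom Iq) // (X_ldiv_hom (XI Iq Xy) (XI Iq Xy')) //.
  exact: inner_hom (XF _ _ Xx Xy) (XF _ _ Xx' Xy').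
- move=> x y Xx Xy; apply: rdiv_eq.
  have Xd := XF _ _ Xx Xy; have Xf := XI Ip' Xd; have Xpy := XI Iq Xy.
  by rewrite E // phiK lmul_rdiv (X_comm Xd Xpy) lmul_ldiv.
Qed.

Lemma coset_relP u v : coset_rel X u v <-> exists2 x, X x & v = u * x.
Proof.
split=> [E|[x Xx ->] w]; first by apply/E; exists 1; rewrite ?lmulx1.
split=> [[y Xy ->]|[y Xy ->]].
- by exists (ldiv x y); [exact: Xldiv|rewrite -X_assocr ?lmul_ldiv //; exact: Xldiv].
- by exists (x * y); [exact: XM|rewrite X_assocr].
Qed.

Lemma affine_op_congr op x x' y y' : affine_op op ->
  coset_rel X x x' -> coset_rel X y y' -> coset_rel X (op x y) (op x' y').
Proof.
move=> aff /coset_relP[a Xa ->] /coset_relP[b Xb ->].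
have [F [XF _ E]] := aff x y.
by apply/coset_relP; exists (F a b); [exact: XF|exact: E].
Qed.

Lemma coset_rel_congruence : congruence (coset_rel X).
Proof.
split.
- by move=> x w.
- by move=> x y E w; apply: iff_sym.
- by move=> x y z E E' w; exact: iff_trans (E w) (E' w).
- by move=> x x' y y'; exact: affine_op_congr affine_op_lmul.
- by move=> x x' y y'; exact: affine_op_congr affine_op_ldiv.
- by move=> x x' y y'; exact: affine_op_congr affine_op_rdiv.
Qed.

(** The shape of the four values in the term condition: [x] records the change from [u] to [v], and
    [y] the change from [a] to [b]. *)
Definition parallelogram (p q r s : Q) : Prop :=
  exists x y, [/\ X x, X y, q = p * x, r = p * y & s = (p * y) * x].

Lemma affine_op_parallelogram op p q r s p' q' r' s' : affine_op op ->
  parallelogram p q r s -> parallelogram p' q' r' s' ->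
  parallelogram (op p p') (op q q') (op r r') (op s s').
Proof.
move=> aff [x [y [Xx Xy -> -> ->]]] [x' [y' [Xx' Xy' -> -> ->]]].
have [F [XF FM E]] := aff p p'.
exists (F x x'), (F y y'); split; try exact: XF; try exact: E.
by rewrite -!X_assocr ?E ?FM //; try exact: XM; exact: XF.
Qed.

Lemma eval_parallelogram n (t : term n) (e1 e2 e3 e4 : n.-tuple Q) :
  (forall i, parallelogram (tnth e1 i) (tnth e2 i) (tnth e3 i) (tnth e4 i)) ->
  parallelogram (eval t e1) (eval t e2) (eval t e3) (eval t e4).
Proof.
move=> H; elim: t => [i||t1 IH1 t2 IH2|t1 IH1 t2 IH2|t1 IH1 t2 IH2] /=.
- exact: H.
- by exists 1, 1; rewrite !lmulx1.
- exact: affine_op_parallelogram affine_op_lmul IH1 IH2.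
- exact: affine_op_parallelogram affine_op_ldiv IH1 IH2.
- exact: affine_op_parallelogram affine_op_rdiv IH1 IH2.
Qed.

Lemma coset_rel_abelian : abelian_congruence (coset_rel X).
Proof.
split=> [|n t a b u v /coset_relP[y Xy ->] uv]; first exact: coset_rel_congruence.
have : parallelogram (eval t [tuple of a :: u]) (eval t [tuple of a :: v])
    (eval t [tuple of a * y :: u]) (eval t [tuple of a * y :: v]).
  (* Each coordinate is degenerate: [y = 1] at the parameters, [x = 1] at the distinguished
     argument. *)
  apply: eval_parallelogram => i; have [j ->|->] := unliftP ord0 i.
    rewrite !tnthS; have /coset_relP[x Xx ->] := uv j.
    by exists x, 1; rewrite !lmulx1.
  by rewrite !tnth0; exists 1, y; rewrite !lmulx1.
move=> [x [y' [_ _ -> -> ->]]] E.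
suff -> : x = 1 by rewrite lmulx1.
by apply: (@lmul_inj _ (eval t [tuple of a :: u])); rewrite -E lmulx1.
Qed.

End Sufficiency.

(** Necessity: apply the term condition to [t(a, b, c) = (b(ca)) / ((ba)c)]. Since
    [t(1, u, x) = 1 = t(1, u, 1)], moving the first argument to [y] gives
    [t(y, u, x) = t(y, u, 1) = 1]. *)
Lemma abelian_congruence_term (Q : loopType) (X : Q -> Prop) :
  subloop X -> induces_abelian_congruence X ->
  forall u x y : Q, X x -> X y -> u * (x * y) = (u * y) * x.
Proof.
move=> sX [_ abX] u x y Xx Xy.
have X1 z : X z -> coset_rel X 1 z.
  move=> Xz w; split=> [[v Xv ->]|[v Xv ->]].
    exists (ldiv z (1 * v)); last by rewrite lmul_ldiv.
    by rewrite lmul1x; exact: (subloop_ldiv sX).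
  by exists (z * v); [exact: (subloopM sX)|rewrite lmul1x].
pose V (i : nat) : term 3 := TVar (inord i).
pose t := TRdiv (TMul (V 1%N) (TMul (V 2%N) (V 0%N))) (TMul (TMul (V 1%N) (V 0%N)) (V 2%N)).
have evalt a b c : eval t [tuple of a :: [tuple b; c]] = rdiv (b * (c * a)) ((b * a) * c).
  by rewrite /t /= !(tnth_nth a) !inordK.
have E : eval t [tuple of y :: [tuple u; x]] = eval t [tuple of y :: [tuple u; 1]].
  apply: (abX 2 t 1 y); first exact: X1.
    move=> i; rewrite !(tnth_nth u); case: i => [[|[|[]]]] //= _.
    by move=> w; exact: iff_sym (X1 _ Xx w).
  by rewrite !evalt !lmulx1 !rdivx1.
move: E; rewrite !evalt lmulx1 lmul1x rdivx1 => E.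
by rewrite -[LHS](lmul_rdiv (u * y * x)) E lmul1x.
Qed.

Theorem theorem2p5 (Q : loopType) (hQ : moufang Q) (h3 : divisible Q 3)
    (X : Q -> Prop) (hX : normal_subloop X) :
  induces_abelian_congruence X <->
  (forall u x y : Q, X x -> X y -> u * (x * y) = (u * y) * x).
Proof.
split; first exact: abelian_congruence_term hX.1.
exact: coset_rel_abelian.
Qed.
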